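(* There exist $H^3$-irreducible finite distributive lattices $L_1$ and $L_2$ such that the weighted double skeleton $S^{\mathrm{wd}}(L_1)$ is isomorphic to $S^{\mathrm{wd}}(L_2)$ but $L_1$ is not isomorphic to $L_2$. Also, there is a finite distributive lattice $L$ such that $\operatorname{length}(\mathrm{Ji}(L))\le 1$ but $L$ is not $H^2$-irreducible.
   Context: All lattices are finite; $\prec$ denotes the covering relation. For a finite poset $Q$, $\operatorname{length}(Q)=\max\{n\in\{0,1,2,\dots\}: Q \text{ has an } (n+1)\text{-element chain}\}$. $\mathrm{Ji}(L)$ is the poset of all non-zero join-irreducible elements of $L$, with the order inherited from $L$. Skeleton. A tolerance of $L$ is a reflexive, symmetric relation $R\subseteq L^2$ compatible with join and meet. A block of $R$ is a maximal subset $X\subseteq L$ with $X\times X\subseteq R$; since $L$ is finite, each block $\alpha$ is an interval $[0_\alpha,1_\alpha]$ of $L$. The set $L/R$ of all blocks is a lattice (the factor lattice), where $\alpha\vee\beta$ is the unique block containing $\{x\vee y: x\in\alpha, y\in\beta\}$ and $\alpha\wedge\beta$ is the unique block containing $\{x\wedge y: x\in\alpha,y\in\beta\}$; in it $\alpha\le\beta\iff 0_\alpha\le 0_\beta\iff 1_\alpha\le 1_\beta$. A tolerance of $L$ is glued if its transitive closure is $L^2$ (equivalently, it contains all pairs $(x,y)$ with $x\prec y$). The skeleton tolerance $\Theta(L)$ is the smallest glued tolerance of $L$, and the skeleton of $L$ is the lattice $S(L):=L/\Theta(L)$. Put $S^0(L):=L$ and $S^{i+1}(L):=S(S^i(L))$.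 $L$ is called $H^n$-irreducible if $|S^n(L)|=1$ (equivalently, the smallest $m$ with $|S^m(L)|=1$, called the Herrmann rank of $L$, is at most $n$). Weighted double skeleton. $S^{\mathrm{wd}}(L)$ is the structure $(P,\le,S(L),\eta_0,\eta_1,\mathsf w)$ where $P=\{0_\alpha:\alpha\in S(L)\}\cup\{1_\alpha:\alpha\in S(L)\}$, $\le$ is the order on $P$ inherited from $L$, $\eta_0,\eta_1\colon S(L)\to P$ are given by $\eta_0(\alpha)=0_\alpha$, $\eta_1(\alpha)=1_\alpha$, and for $x\prec y$ in the poset $P$, $\mathsf w(x,y):=\operatorname{length}([x,y]_L)$, the length of the interval $[x,y]$ of $L$. An isomorphism from $(P,\le,K,\eta_0,\eta_1,\mathsf w)$ to $(P',\le',K',\eta_0',\eta_1',\mathsf w')$ is a pair $(\psi,\kappa)$ where $\psi\colon P\to P'$ is an order isomorphism, $\kappa\colon K\to K'$ is a lattice isomorphism, $\psi(\eta_i(x))=\eta_i'(\kappa(x))$ for all $x\in K$, $i\in\{0,1\}$, and $\mathsf w(x,y)=\mathsf w'(\psi(x),\psi(y))$ for all $x\prec y$ in $P$. Two weighted double skeletons are isomorphic if such a pair exists. *)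

(* Defs.v *)
From HB Require Import structures.
From mathcomp Require Import all_boot all_order.

Set Implicit Arguments.
Unset Strict Implicit.
Unset Printing Implicit Defensive.

Import Order.Theory.
Local Open Scope order_scope.

(* Finite lattices are nonempty, i.e., finTBLatticeType. *)

Section FinitePosets.
Context {d : Order.disp_t} {T : finPOrderType d}.

Definition chain (C : {set T}) : bool := [forall x in C, forall y in C, x >=< y].

(* Length of the subposet Q; it is 0 for Q = set0, where the maximum is taken
   over an empty set. The bound #|Q| only makes the range finite: a chain of Q
   has at most #|Q| elements. *)
Definition length (Q : {set T}) : nat :=
  (\max_(n < #|Q| | [exists C : {set T},
                      [&& C \subset Q, chain C & #|C| == n.+1]]) n)%N.

Definition itv (x y : T) : {set T} := [set z | x <= z <= y].

Definition covers (x y : T) : bool :=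
  (x < y) && [forall z, ~~ (x < z < y)].

End FinitePosets.

Definition Ji d (L : finTBLatticeType d) : {set L} :=
  [set x | (x != \bot) &&
           [forall y, forall z, (x == y `|` z) ==> (x == y) || (x == z)]].

Definition lattice_iso d1 (L1 : latticeType d1) d2 (L2 : latticeType d2)
    (f : L1 -> L2) : Prop :=
  [/\ bijective f, {morph f : x y / x `&` y >-> x `&` y}
    & {morph f : x y / x `|` y >-> x `|` y}].

Definition lattice_isomorphic d1 (L1 : latticeType d1)
    d2 (L2 : latticeType d2) : Prop :=
  exists f : L1 -> L2, lattice_iso f.

Section Tolerance.
Context {d : Order.disp_t} {L : finTBLatticeType d}.
Implicit Type R : {set L * L}.

Definition tolerance R : bool :=
  [&& [forall x, (x, x) \in R],
      [forall x, forall y, ((x, y) \in R) ==> ((y, x) \in R)]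
    & [forall p in R, forall q in R,
         ((p.1 `&` q.1, p.2 `&` q.2) \in R)
      && ((p.1 `|` q.1, p.2 `|` q.2) \in R)]].

(* connect is the reflexive-transitive closure, which is the transitive
   closure when R is reflexive. *)
Definition glued R : bool :=
  [forall x, forall y, connect (fun a b => (a, b) \in R) x y].

Record tolType := Tol { tol_set :> {set L * L}; tolP : tolerance tol_set }.

End Tolerance.
Arguments tolType {d} L.

Section Blocks.
Context {d : Order.disp_t} {L : finTBLatticeType d} (R : tolType L).

Definition is_block (X : {set L}) : bool :=
  maxset (fun Y : {set L} => setX Y Y \subset (R : {set L * L})) X.

Record factor := Block { block_set :> {set L}; blockP : is_block block_set }.

HB.instance Definition _ := [isSub for block_set].
HB.instance Definition _ := [Finite of factor by <:].

(* Every block is the interval [blk0 a, blk1 a], see mem_block. *)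
Definition blk0 (a : factor) : L := \meet_(x in block_set a) x.
Definition blk1 (a : factor) : L := \join_(x in block_set a) x.

Definition block_le (a b : factor) : bool := blk0 a <= blk0 b.

(* The default value a is never used: a suitable block exists and is unique,
   see block_join_uniq and block_meet_uniq. *)
Definition block_join (a b : factor) : factor :=
  odflt a [pick c : factor |
    [set x `|` y | x in block_set a, y in block_set b] \subset block_set c].
Definition block_meet (a b : factor) : factor :=
  odflt a [pick c : factor |
    [set x `&` y | x in block_set a, y in block_set b] \subset block_set c].

Lemma tol_refl x : (x, x) \in (R : {set L * L}).
Proof. by case/and3P: (tolP R) => /forallP. Qed.

Lemma tol_sym x y : (x, y) \in (R : {set L * L}) -> (y, x) \in (R : {set L * L}).
Proof.
by case/and3P: (tolP R) => _ /forallP/(_ x)/forallP/(_ y)/implyP.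
Qed.

Lemma tolI x y z t : (x, y) \in (R : {set L * L}) ->
  (z, t) \in (R : {set L * L}) -> (x `&` z, y `&` t) \in (R : {set L * L}).
Proof.
move=> Rxy Rzt; case/and3P: (tolP R) => _ _ /forall_inP/(_ _ Rxy).
by move=> /forall_inP/(_ _ Rzt)/andP[].
Qed.

Lemma tolU x y z t : (x, y) \in (R : {set L * L}) ->
  (z, t) \in (R : {set L * L}) -> (x `|` z, y `|` t) \in (R : {set L * L}).
Proof.
move=> Rxy Rzt; case/and3P: (tolP R) => _ _ /forall_inP/(_ _ Rxy).
by move=> /forall_inP/(_ _ Rzt)/andP[].
Qed.

Lemma tol_convex u v x y : (u, v) \in (R : {set L * L}) ->
  u <= x -> x <= v -> u <= y -> y <= v -> (x, y) \in (R : {set L * L}).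
Proof.
move=> Ruv ux xv uy yv.
have Rxv : (x, v) \in (R : {set L * L}).
  by have := tolU Ruv (tol_refl x); rewrite (join_r ux) (join_l xv).
have Rvy : (v, y) \in (R : {set L * L}).
  by have := tolU (tol_sym Ruv) (tol_refl y); rewrite (join_l yv) (join_r uy).
by have := tolI Rxv Rvy; rewrite (meet_l xv) (meet_r yv).
Qed.

Let up (a : L) : L := \join_(y | (a, y) \in (R : {set L * L})) y.
Let dn (a : L) : L := \meet_(y | (a, y) \in (R : {set L * L})) y.

Let le_up a y : (a, y) \in (R : {set L * L}) -> y <= up a.
Proof. exact: (joins_sup id). Qed.

Let ge_dn a y : (a, y) \in (R : {set L * L}) -> dn a <= y.
Proof. exact: (meets_inf id). Qed.

Let up_ge a : a <= up a. Proof. exact/le_up/tol_refl. Qed.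
Let dn_le a : dn a <= a. Proof. exact/ge_dn/tol_refl. Qed.

Let tol_up a : (a, up a) \in (R : {set L * L}).
Proof.
suff : (a, a `|` up a) \in (R : {set L * L}) by rewrite (join_r (up_ge a)).
rewrite /up; elim/big_ind: _ => [|x y Rx Ry|x Rx].
- by rewrite joinx0 tol_refl.
- by have := tolU Rx Ry; rewrite joinxx joinACA joinxx.
- by have := tolU (tol_refl a) Rx; rewrite joinxx.
Qed.

Let tol_dn a : (a, dn a) \in (R : {set L * L}).
Proof.
suff : (a, a `&` dn a) \in (R : {set L * L}) by rewrite (meet_r (dn_le a)).
rewrite /dn; elim/big_ind: _ => [|x y Rx Ry|x Rx].
- by rewrite meetx1 tol_refl.
- by have := tolI Rx Ry; rewrite meetxx meetACA meetxx.
- by have := tolI (tol_refl a) Rx; rewrite meetxx.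
Qed.

Let up_homo a b : a <= b -> up a <= up b.
Proof.
move=> ab; apply: le_trans (le_up _); first exact: leUl.
by have := tolU (tol_up a) (tol_refl b); rewrite (join_r ab).
Qed.

Let dn_homo a b : a <= b -> dn a <= dn b.
Proof.
move=> ab; apply: le_trans (ge_dn _) (leIr _ a).
by have := tolI (tol_refl a) (tol_dn b); rewrite (meet_l ab).
Qed.

Let dnup_le a : dn (up a) <= a.
Proof. exact/ge_dn/tol_sym/tol_up. Qed.

Let updn_ge a : a <= up (dn a).
Proof. exact/le_up/tol_sym/tol_dn. Qed.

Let updnup a : up (dn (up a)) = up a.
Proof. by apply/le_anti; rewrite updn_ge up_homo ?dnup_le. Qed.

Lemma block_tol (a : factor) x y : x \in block_set a -> y \in block_set a ->
  (x, y) \in (R : {set L * L}).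
Proof.
move=> ax ay; case/maxsetP: (blockP a) => /subsetP/(_ (x, y)) + _.
by apply; rewrite in_setX ax.
Qed.

Lemma block_max (a : factor) x :
  (forall y, y \in block_set a -> (x, y) \in (R : {set L * L})) ->
  x \in block_set a.
Proof.
move=> Rx; case/maxsetP: (blockP a) => _ /(_ (x |: block_set a)) <-.
- by rewrite setU11.
- apply/subsetP => -[y z]; rewrite in_setX !in_setU1 /=.
  case/andP => /predU1P[->|ay] /predU1P[->|az]; rewrite ?tol_refl ?Rx //.
    by rewrite tol_sym ?Rx.
  exact: block_tol ay az.
- exact: subsetU1.
Qed.

Lemma block_neq0 (a : factor) : exists x, x \in block_set a.
Proof.
case: (set_0Vmem (block_set a)) => [a0|[x ax]]; last by exists x.
by exists \bot; apply: block_max => y; rewrite a0 inE.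
Qed.

Lemma blk0_mem (a : factor) : blk0 a \in block_set a.
Proof.
apply: block_max => y ay; have [x ax] := block_neq0 a.
suff : (x `&` blk0 a, y) \in (R : {set L * L}).
  by rewrite (meet_r _) //; apply: (meets_inf id).
rewrite /blk0; elim/big_ind: _ => [|z t Rz Rt|z az].
- by rewrite meetx1 (block_tol ax).
- by have := tolI Rz Rt; rewrite meetACA !meetxx.
- by have := tolI (block_tol ax ay) (block_tol az ay); rewrite meetxx.
Qed.

Lemma blk1_mem (a : factor) : blk1 a \in block_set a.
Proof.
apply: block_max => y ay; have [x ax] := block_neq0 a.
suff : (x `|` blk1 a, y) \in (R : {set L * L}).
  by rewrite (join_r _) //; apply: (joins_sup id).
rewrite /blk1; elim/big_ind: _ => [|z t Rz Rt|z az].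
- by rewrite joinx0 (block_tol ax).
- by have := tolU Rz Rt; rewrite joinACA !joinxx.
- by have := tolU (block_tol ax ay) (block_tol az ay); rewrite joinxx.
Qed.

Lemma mem_block (a : factor) x :
  (x \in block_set a) = (blk0 a <= x <= blk1 a).
Proof.
apply/idP/andP => [ax|[ax xa]]; first by split; [exact: (meets_inf id)|exact: (joins_sup id)].
apply: block_max => y ay.
apply: tol_convex (block_tol (blk0_mem a) (blk1_mem a)) _ _ _ _ => //.
- exact: (meets_inf id).
- exact: (joins_sup id).
Qed.

Let blk01 (a : factor) : blk0 a <= blk1 a.
Proof. by have := blk0_mem a; rewrite mem_block => /andP[]. Qed.

Let up_blk0 (a : factor) : up (blk0 a) = blk1 a.
Proof.
apply/le_anti; rewrite le_up ?(block_tol (blk0_mem a) (blk1_mem a)) // andbT.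
have le1 : blk1 a <= up (blk0 a).
  by rewrite le_up ?(block_tol (blk0_mem a) (blk1_mem a)).
suff : up (blk0 a) \in block_set a by rewrite mem_block => /andP[].
apply: block_max => y; rewrite mem_block => /andP[ay ya].
apply: (tol_convex (tol_up (blk0 a))) => //.
exact: le_trans ya le1.
Qed.

Let dn_blk1 (a : factor) : dn (blk1 a) = blk0 a.
Proof.
apply/le_anti; rewrite ge_dn ?(block_tol (blk1_mem a) (blk0_mem a)) //=.
have le0 : dn (blk1 a) <= blk0 a.
  by rewrite ge_dn ?(block_tol (blk1_mem a) (blk0_mem a)).
suff : dn (blk1 a) \in block_set a by rewrite mem_block => /andP[].
apply: block_max => y; rewrite mem_block => /andP[ay ya].
apply: (tol_convex (tol_sym (tol_dn (blk1 a)))) => //.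
exact: le_trans le0 ay.
Qed.

Lemma blk0_inj : injective blk0.
Proof.
move=> a b ab; apply/val_inj/setP => x /=.
by rewrite !mem_block -!up_blk0 ab.
Qed.

Lemma block_leE1 (a b : factor) : block_le a b = (blk1 a <= blk1 b).
Proof.
rewrite /block_le; apply/idP/idP => ab; first by rewrite -!up_blk0 up_homo.
by rewrite -!dn_blk1 dn_homo.
Qed.

Let exists_block x : exists a : factor, blk0 a = dn (up x) /\ blk1 a = up x.
Proof.
have tolx : (dn (up x), up x) \in (R : {set L * L}) by rewrite -{2}updnup tol_up.
have lex : dn (up x) <= up x by apply: dn_le.
have bX : is_block (itv (dn (up x)) (up x)).
  apply/maxsetP; split.
    apply/subsetP => -[y z]; rewrite in_setX !inE /= => /andP[/andP[? ?] /andP[? ?]].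
    exact: tol_convex tolx _ _ _ _.
  move=> B /subsetP BR BX; apply/eqP; rewrite eqEsubset BX andbT.
  apply/subsetP => y By; rewrite inE.
  have /BR Ry : (up x, y) \in setX B B.
    by rewrite in_setX By andbT (subsetP BX) // inE lex lexx.
  have /BR Ry' : (dn (up x), y) \in setX B B.
    by rewrite in_setX By andbT (subsetP BX) // inE lex lexx.
  by rewrite (ge_dn Ry) -(updnup x) le_up.
have mX z : (z \in block_set (Block bX)) = (dn (up x) <= z <= up x).
  by rewrite inE.
exists (Block bX).
have := blk0_mem (Block bX); have := blk1_mem (Block bX); rewrite !mX.
move=> /andP[l1 u1] /andP[l0 u0]; split; apply/le_anti.
  by rewrite l0 andbT (meets_inf id) // mX lexx lex.
by rewrite u1 (joins_sup id) // mX lexx lex.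
Qed.

Let subU a b (c : factor) :
  ([set x `|` y | x in block_set a, y in block_set b] \subset block_set c)
  = (blk0 c == blk0 a `|` blk0 b).
Proof.
apply/subsetP/eqP => [sub|c0 _ /imset2P[x y + + ->]].
  have /sub : blk0 a `|` blk0 b \in
      [set x `|` y | x in block_set a, y in block_set b].
    by apply: imset2_f; apply: blk0_mem.
  have /sub : blk1 a `|` blk1 b \in
      [set x `|` y | x in block_set a, y in block_set b].
    by apply: imset2_f; apply: blk1_mem.
  rewrite !mem_block !leUx => /andP[_ /andP[ac bc]] /andP[le0 _].
  apply/le_anti; rewrite le0 leUx.
  by move: (block_leE1 a c) (block_leE1 b c); rewrite /block_le ac bc => -> ->.
rewrite !mem_block => /andP[x0 x1] /andP[y0 y1].
rewrite c0 leU2 //= leUx -(up_blk0 c) c0.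
apply/andP; split; [apply: (le_trans x1)|apply: (le_trans y1)].
  by rewrite -up_blk0 up_homo ?leUl.
by rewrite -up_blk0 up_homo ?leUr.
Qed.

Let subI a b (c : factor) :
  ([set x `&` y | x in block_set a, y in block_set b] \subset block_set c)
  = (blk1 c == blk1 a `&` blk1 b).
Proof.
apply/subsetP/eqP => [sub|c1 _ /imset2P[x y + + ->]].
  have /sub : blk0 a `&` blk0 b \in
      [set x `&` y | x in block_set a, y in block_set b].
    by apply: imset2_f; apply: blk0_mem.
  have /sub : blk1 a `&` blk1 b \in
      [set x `&` y | x in block_set a, y in block_set b].
    by apply: imset2_f; apply: blk1_mem.
  rewrite !mem_block !lexI => /andP[_ le1] /andP[/andP[ca cb] _].
  apply/le_anti; rewrite le1 lexI.
  by move: (block_leE1 c a) (block_leE1 c b); rewrite /block_le ca cb => <- <-.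
rewrite !mem_block => /andP[x0 x1] /andP[y0 y1].
rewrite c1 leI2 // andbT lexI -(dn_blk1 c) c1.
apply/andP; split; [apply: le_trans x0|apply: le_trans y0].
  by rewrite -dn_blk1 dn_homo ?leIl.
by rewrite -dn_blk1 dn_homo ?leIr.
Qed.

Let ex_join a b : exists c : factor, blk0 c = blk0 a `|` blk0 b.
Proof.
have [c [c0 _]] := exists_block (blk0 a `|` blk0 b); exists c; rewrite c0.
have le x : blk0 x <= blk0 a `|` blk0 b -> blk0 x <= dn (up (blk0 a `|` blk0 b)).
  by move=> lex; rewrite -(dn_blk1 x) dn_homo // -up_blk0 up_homo.
by apply/le_anti; rewrite dnup_le leUx !le ?leUl ?leUr.
Qed.

Let ex_meet a b : exists c : factor, blk1 c = blk1 a `&` blk1 b.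
Proof.
have [c [_ c1]] := exists_block (dn (blk1 a `&` blk1 b)); exists c; rewrite c1.
have le x : blk1 a `&` blk1 b <= blk1 x -> up (dn (blk1 a `&` blk1 b)) <= blk1 x.
  by move=> lex; rewrite -(up_blk0 x) up_homo // -dn_blk1 dn_homo.
by apply/le_anti; rewrite updn_ge lexI !le ?leIl ?leIr.
Qed.

Lemma blk0_join a b : blk0 (block_join a b) = blk0 a `|` blk0 b.
Proof.
rewrite /block_join; case: pickP => [c|none] /=; first by rewrite subU => /eqP.
by have [c c0] := ex_join a b; have := none c; rewrite subU c0 eqxx.
Qed.

Lemma blk1_meet a b : blk1 (block_meet a b) = blk1 a `&` blk1 b.
Proof.
rewrite /block_meet; case: pickP => [c|none] /=; first by rewrite subI => /eqP.
by have [c c1] := ex_meet a b; have := none c; rewrite subI c1 eqxx.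
Qed.

Lemma block_join_uniq (a b c : factor) :
  reflect (c = block_join a b)
    ([set x `|` y | x in block_set a, y in block_set b] \subset block_set c).
Proof.
rewrite subU -blk0_join; apply: (iffP eqP) => [/blk0_inj //|-> //].
Qed.

Lemma block_meet_uniq (a b c : factor) :
  reflect (c = block_meet a b)
    ([set x `&` y | x in block_set a, y in block_set b] \subset block_set c).
Proof.
rewrite subI -blk1_meet; apply: (iffP eqP) => [e|-> //].
by apply: blk0_inj; rewrite -!dn_blk1 e.
Qed.

Lemma block_le_refl : reflexive block_le.
Proof. by move=> a; apply: lexx. Qed.

Lemma block_le_anti : antisymmetric block_le.
Proof. by move=> a b ab; apply/blk0_inj/le_anti. Qed.

Lemma block_le_trans : transitive block_le.
Proof. by move=> b a c; apply: le_trans. Qed.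

HB.instance Definition _ :=
  Order.Le_isPOrder.Build d factor block_le_refl block_le_anti block_le_trans.

Lemma block_lexI a b c : (a <= block_meet b c) = (a <= b) && (a <= c).
Proof.
transitivity (blk1 a <= blk1 b `&` blk1 c).
  by rewrite -blk1_meet -block_leE1.
by rewrite lexI -!block_leE1.
Qed.

Lemma block_leUx a b c : (block_join a b <= c) = (a <= c) && (b <= c).
Proof.
transitivity (blk0 a `|` blk0 b <= blk0 c); last exact: leUx.
by rewrite -blk0_join.
Qed.

HB.instance Definition _ :=
  Order.POrder_isMeetSemilattice.Build d factor block_lexI.
HB.instance Definition _ :=
  Order.POrder_isJoinSemilattice.Build d factor block_leUx.

Lemma ex_block_bot : exists a : factor, \bot \in block_set a.
Proof.
have [a [a0 a1]] := exists_block \bot.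
by exists a; rewrite mem_block a0 dnup_le le0x.
Qed.

Lemma ex_block_top : exists a : factor, \top \in block_set a.
Proof.
have [a [a0 a1]] := exists_block (dn \top).
by exists a; rewrite mem_block a1 updn_ge lex1.
Qed.

Lemma block_le0x a : xchoose ex_block_bot <= a.
Proof.
suff : blk0 (xchoose ex_block_bot) <= blk0 a by [].
apply: le_trans (le0x (blk0 a)).
by have := xchooseP ex_block_bot; rewrite mem_block => /andP[].
Qed.

Lemma block_lex1 a : a <= xchoose ex_block_top.
Proof.
suff : blk1 a <= blk1 (xchoose ex_block_top) by rewrite -block_leE1.
apply: le_trans (lex1 (blk1 a)) _.
by have := xchooseP ex_block_top; rewrite mem_block => /andP[].
Qed.

HB.instance Definition _ := Order.hasBottom.Build d factor block_le0x.
HB.instance Definition _ := Order.hasTop.Build d factor block_lex1.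

End Blocks.

Section Skeleton.
Context {d : Order.disp_t} (L : finTBLatticeType d).

(* The smallest glued tolerance, as the intersection of all of them; it is
   itself glued by skel_tol_glued. *)
Definition skel_tol_set : {set L * L} :=
  \bigcap_(R : {set L * L} | tolerance R && glued R) R.

Lemma skel_tol_subproof : tolerance skel_tol_set.
Proof.
apply/and3P; split.
- by apply/forallP => x; apply/bigcapP => R /andP[tR _]; apply: (tol_refl (Tol tR)).
- apply/forallP => x; apply/forallP => y; apply/implyP => /bigcapP Rxy.
  apply/bigcapP => R RP; have /andP[tR _] := RP.
  exact: (@tol_sym _ _ (Tol tR)) (Rxy R RP).
- apply/forall_inP => -[x y] /bigcapP Rxy; apply/forall_inP => -[z t] /bigcapP Rzt.
  apply/andP; split; apply/bigcapP => R RP; have /andP[tR _] := RP.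
    exact: (@tolI _ _ (Tol tR)) (Rxy R RP) (Rzt R RP).
  exact: (@tolU _ _ (Tol tR)) (Rxy R RP) (Rzt R RP).
Qed.

Definition skel_tol : tolType L := Tol skel_tol_subproof.

Definition skeleton : finTBLatticeType d := factor skel_tol.

Lemma glued_covers (R : tolType L) :
  reflect (forall x y, covers x y -> (x, y) \in (R : {set L * L})) (glued R).
Proof.
apply: (iffP forallP) => [gl x y /andP[xy /forallP cov]|cov].
  have /connectP[p pth] := forallP (gl x) y.
  have proj z : ((z `|` x) `&` y == x) || ((z `|` x) `&` y == y).
    have lez : x <= (z `|` x) `&` y by rewrite lexI leUr ltW.
    have := cov ((z `|` x) `&` y); rewrite !lt_neqAle lez leIr !andbT.
    by rewrite negb_and !negbK (eq_sym x).
  move=> /esym ey; move: pth.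
  have : (x `|` x) `&` y = x by rewrite joinxx (meet_l (ltW xy)).
  move: ey; move: {1 2 5}x => u; elim: p u => [|v p IHp] u /=.
    by move=> -> e _; move: xy; rewrite -{1}e meetC joinKI ltxx.
  move=> ey e /andP[Ruv pth].
  case/orP: (proj v) => /eqP ev; first exact: (IHp v).
  by have := tolI (tolU Ruv (tol_refl R x)) (tol_refl R y); rewrite e ev.
have step n (x y : L) : (#|itv x y| <= n)%N -> x <= y ->
    connect (fun a b => (a, b) \in (R : {set L * L})) x y.
  elim: n x y => [|n IHn] x y leN xy.
    by move: leN; rewrite leqn0 cards_eq0 => /eqP/setP/(_ x); rewrite !inE lexx xy.
  have [->|nxy] := eqVneq x y; first exact: connect0.
  have {nxy} lxy : x < y by rewrite lt_neqAle nxy.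
  case: (boolP (covers x y)) => [/cov Rxy|]; first exact: connect1.
  rewrite /covers lxy /= negb_forall => /existsP[z]; rewrite negbK => /andP[xz zy].
  apply: (@connect_trans _ _ z); apply: IHn; rewrite ?ltW //.
    rewrite -ltnS; apply: leq_trans leN; apply: proper_card; apply/properP; split.
      by apply/subsetP => t; rewrite !inE => /andP[-> /le_trans->] //; apply: ltW.
    by exists y; rewrite !inE ?xy ?lexx // (lt_geF zy) andbF.
  rewrite -ltnS; apply: leq_trans leN; apply: proper_card; apply/properP; split.
    by apply/subsetP => t; rewrite !inE => /andP[zt ->]; rewrite (le_trans (ltW xz)).
  by exists x; rewrite !inE ?xy ?lexx // (lt_geF xz).
have sym : connect_sym (fun a b => (a, b) \in (R : {set L * L})).
  by apply: sym_connect_sym => a b; apply/idP/idP; apply: tol_sym.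
move=> x; apply/forallP => y; apply: (@connect_trans _ _ (x `|` y)).
  exact: step (leqnn _) (leUl _ _).
by rewrite sym; apply: step (leqnn _) (leUr _ _).
Qed.

Lemma skel_tol_glued : glued skel_tol.
Proof.
apply/glued_covers => x y xy; apply/bigcapP => R /andP[tR gR].
exact: (glued_covers (Tol tR) gR).
Qed.

End Skeleton.

Definition iter_skeleton (n : nat) d (L : finTBLatticeType d) :
  finTBLatticeType d := iter n (@skeleton d) L.

Definition H_irreducible (n : nat) d (L : finTBLatticeType d) : bool :=
  #|[set: iter_skeleton n L]| == 1%N.

Section DoubleSkeleton.
Context {d : Order.disp_t} (L : finTBLatticeType d).

Definition dskel_set : {set L} :=
  [set blk0 a | a : skeleton L] :|: [set blk1 a | a : skeleton L].

Record dskel := DSkel { dskel_val :> L; dskelP : dskel_val \in dskel_set }.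

HB.instance Definition _ := [isSub for dskel_val].
HB.instance Definition _ := [Finite of dskel by <:].
HB.instance Definition _ := [SubChoice_isSubPOrder of dskel by <: with d].

Lemma dskel_blk0 (a : skeleton L) : blk0 a \in dskel_set.
Proof. by rewrite inE imset_f. Qed.

Lemma dskel_blk1 (a : skeleton L) : blk1 a \in dskel_set.
Proof. by rewrite inE imset_f ?orbT. Qed.

End DoubleSkeleton.

(* The weight is total here, but only its values at covering pairs of wds_P
   are part of the structure; wds_iso ignores the others. *)
Record wdskeleton (d : Order.disp_t) := WDSkeleton {
  wds_P : finPOrderType d;
  wds_K : finTBLatticeType d;
  wds_eta0 : wds_K -> wds_P;
  wds_eta1 : wds_K -> wds_P;
  wds_w : wds_P -> wds_P -> nat
}.

Definition Swd d (L : finTBLatticeType d) : wdskeleton d :=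
  @WDSkeleton d (dskel L) (skeleton L)
    (fun a => DSkel (dskel_blk0 a)) (fun a => DSkel (dskel_blk1 a))
    (fun x y => length (itv (x : L) (y : L))).

Definition wds_iso d1 (W1 : wdskeleton d1) d2 (W2 : wdskeleton d2)
    (psi : wds_P W1 -> wds_P W2) (kappa : wds_K W1 -> wds_K W2) : Prop :=
  [/\ bijective psi /\ {mono psi : x y / x <= y}, lattice_iso kappa,
      forall a, psi (wds_eta0 a) = wds_eta0 (kappa a),
      forall a, psi (wds_eta1 a) = wds_eta1 (kappa a)
    & forall x y : wds_P W1, covers x y -> wds_w x y = wds_w (psi x) (psi y)].

Definition wds_isomorphic d1 (W1 : wdskeleton d1)
    d2 (W2 : wdskeleton d2) : Prop :=
  exists psi kappa, @wds_iso d1 W1 d2 W2 psi kappa.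

(* Main.v *)
Require Import Defs.
From HB Require Import structures.
From mathcomp Require Import all_boot all_order.

(** Finite distributive lattices are taken as lattices of down-sets of a strict
    order [e].  There the skeleton tolerance relates two down-sets exactly when
    their symmetric difference is an antichain, so that a block with bounds
    [D <= E] is determined by either of them: [E] adds to [D] the minimal
    elements of its complement, and [D] removes from [E] its maximal elements.

    All examples come from one family of orders: an antichain [X], an element
    [c] below the members of [X] outside [Z], and an element [b] above [c] and
    above the members of [Y].  If [Y] is nonempty and [Z] is not all of [X], the
    skeleton is the three-element chain with blocks [[0, c + Z]], [[c, c + X]]
    and [[c + Y, 1]].  The skeleton of an
    [n]-element chain with [n > 1] is an [(n-1)]-element chain, so the Herrmann
    rank is exactly three.  If neither of [Y] and [Z] contains the other, the
    weighted double skeleton only sees the cardinalities of [X], [Y] and [Z], not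
    that of their intersections, whereas the lattice is a product of three
    nontrivial factors if and only if [Z \ Y] has at least two elements.  If [Y]
    is contained in [Z], then [X + {c, b}] has no three-element chain. *)

Set Implicit Arguments.
Unset Strict Implicit.
Unset Printing Implicit Defensive.

Import Order.Theory.
Local Open Scope order_scope.

(** * Blocks and the least glued tolerance *)

Section SkeletonTheory.
Context {d : Order.disp_t} (L : finTBLatticeType d).
Implicit Type R : tolType L.

(** The square of the pair set lies in [R], so this set extends to a maximal one. *)
Lemma ex_block R x y : (x, y) \in (R : {set L * L}) ->
  exists a : factor R, x \in block_set a /\ y \in block_set a.
Proof.
move=> Rxy.
have P0 : setX [set x; y] [set x; y] \subset (R : {set L * L}).
  apply/subsetP => -[u v]; rewrite in_setX !inE /=.
  by case/andP=> /orP[]/eqP-> /orP[]/eqP->; rewrite ?tol_refl ?(tol_sym Rxy).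
have [B maxB sB] := @maxset_exists _
  (fun Y => setX Y Y \subset (R : {set L * L})) _ P0.
by exists (Block maxB); split; apply: (subsetP sB); rewrite !inE eqxx ?orbT.
Qed.

Lemma blk0_le_blk1 R (a : factor R) : blk0 a <= blk1 a.
Proof. by have := blk0_mem a; rewrite mem_block => /andP[]. Qed.

Lemma skel_tolE R : glued R ->
  (forall S : tolType L, glued S -> (R : {set L * L}) \subset S) ->
  skel_tol_set L = R.
Proof.
move=> gR minR; apply/eqP; rewrite eqEsubset bigcap_inf ?tolP //=.
by apply/bigcapsP => S /andP[tS gS]; apply: (minR (Tol tS)).
Qed.

End SkeletonTheory.

(** * Skeletons of finite chains *)

Section ChainSkeleton.
Context {d : Order.disp_t} (K : finTBLatticeType d).
Hypothesis totK : total (<=%O : rel K).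

Definition chain_tol_set : {set K * K} :=
  [set p | [forall w, ~~ (p.1 < w < p.2) && ~~ (p.2 < w < p.1)]].

Lemma chain_tolP x y : reflect (forall w, ~~ (x < w < y) /\ ~~ (y < w < x))
  ((x, y) \in chain_tol_set).
Proof. by rewrite inE; apply: (iffP forallP) => h w; apply/andP/h. Qed.

Lemma total_ltI (x y w : K) :
  ((x `&` y < w) = (x < w) || (y < w)) * ((w < x `&` y) = (w < x) && (w < y)).
Proof.
wlog xy : x y / x <= y.
  move=> h; case/orP: (totK x y) => [/h //|/h {h}].
  by rewrite meetC orbC andbC.
rewrite (meet_l xy); split; apply/idP/idP => [h|].
- by rewrite h.
- by case/orP=> //; apply: le_lt_trans.
- by rewrite h (lt_le_trans h).
- by case/andP.
Qed.

Lemma total_ltU (x y w : K) :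
  ((w < x `|` y) = (w < x) || (w < y)) * ((x `|` y < w) = (x < w) && (y < w)).
Proof.
wlog xy : x y / y <= x.
  move=> h; case/orP: (totK x y) => [/h {h}|/h //].
  by rewrite joinC orbC andbC.
rewrite (join_l xy); split; apply/idP/idP => [h|].
- by rewrite h.
- by case/orP=> // h; apply: lt_le_trans h xy.
- by rewrite h (le_lt_trans xy).
- by case/andP.
Qed.

(** Meets and joins are minima and maxima. An element strictly between two minima is above one of
    the left arguments and below both right ones, hence strictly between the members of one of the
    given pairs; maxima are dual. *)
Lemma chain_tol_tolerance : tolerance chain_tol_set.
Proof.
apply/and3P; split.
- by apply/forallP=> x; apply/chain_tolP => w; rewrite andbC lt_asym.
- apply/forallP => x; apply/forallP => y; apply/implyP => /chain_tolP h.
  by apply/chain_tolP => w; have [] := h w.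
- apply/forall_inP => -[x y] /chain_tolP h; apply/forall_inP => -[z t] /chain_tolP h'.
  apply/andP; split; apply/chain_tolP => w; have [h1 h2] := h w; have [h3 h4] := h' w.
    rewrite !total_ltI; split.
      apply/negP => /andP[/orP[a|a] /andP[b c]].
        by rewrite a b in h1.
      by rewrite a c in h3.
    apply/negP => /andP[/orP[a|a] /andP[b c]].
      by rewrite a b in h2.
    by rewrite a c in h4.
  rewrite !total_ltU; split.
    apply/negP => /andP[/andP[b c] /orP[a|a]].
      by rewrite a b in h1.
    by rewrite a c in h3.
  apply/negP => /andP[/andP[b c] /orP[a|a]].
    by rewrite a b in h2.
  by rewrite a c in h4.
Qed.

(** In a chain the related pairs are the equal ones and the coverings, in either order, and every
    glued tolerance contains these. *)
Lemma skel_tol_chain : skel_tol_set K = chain_tol_set.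
Proof.
apply: (skel_tolE (R := Tol chain_tol_tolerance)).
  apply/glued_covers => x y /andP[xy /forallP cov].
  apply/(chain_tolP x y) => w.
  by split=> //; apply/negP => /andP[/lt_trans h /h]; rewrite (lt_gtF xy).
have cov x y : (x, y) \in chain_tol_set -> x < y -> covers x y.
  by move/chain_tolP => h xy; apply/andP; split=> //; apply/forallP=> w; case: (h w).
move=> S /glued_covers gS; apply/subsetP => -[x y] Rxy.
have [->|nxy] := eqVneq x y; first exact: tol_refl.
case/orP: (totK x y) => le; first by apply/gS/cov => //; rewrite lt_neqAle nxy.
apply/tol_sym/gS/cov; first exact: (tol_sym (R := Tol chain_tol_tolerance)).
by rewrite lt_neqAle eq_sym nxy.
Qed.

Lemma total_skeleton : total (<=%O : rel (skeleton K)).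
Proof. by move=> a b; apply: totK. Qed.

Lemma ex_chain_cover (x : K) : x != \top ->
  exists2 y, x < y & (x, y) \in chain_tol_set.
Proof.
move=> xT; have xT' : x < \top by rewrite lt_neqAle xT lex1.
case: (arg_minnP (fun y : K => #|itv x y|) xT') => y xy ymin.
exists y => //; apply/chain_tolP => w; split; apply/negP => /andP[h1 h2].
  have := ymin w h1; rewrite leqNgt => /negP[]; apply/proper_card/properP; split.
    by apply/subsetP => t; rewrite !inE => /andP[-> /le_trans->] //; apply: ltW.
  by exists y; rewrite !inE ?lexx ?(ltW xy) // (lt_geF h2) andbF.
by have := lt_trans h1 h2; rewrite (lt_gtF xy).
Qed.

Lemma ex_chain_cocover : (\bot : K) != \top ->
  exists2 y : K, y < \top & (y, \top) \in chain_tol_set.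
Proof.
move=> bT; have xT' : (\bot : K) < \top by rewrite lt_neqAle bT lex1.
case: (@arg_minnP _ \bot (fun y : K => y < \top) (fun y => #|itv y \top|) xT').
move=> y xy ymin.
exists y => //. apply/chain_tolP => w; split; apply/negP => /andP[h1 h2].
  have := ymin w h2; rewrite leqNgt => /negP[]; apply/proper_card/properP; split.
    by apply/subsetP => t; rewrite !inE !lex1 !andbT; apply/le_trans/ltW.
  by exists y; rewrite !inE ?lexx ?(ltW xy) // (lt_geF h1).
by have := lt_trans h1 h2; rewrite (lt_gtF xy).
Qed.

(** Blocks are counted by their lower bounds, which turn out to be all elements except the top. *)
Lemma card_total_skeleton : (1 < #|K|)%N -> #|skeleton K| = #|K|.-1.
Proof.
move=> K2.
have bT : (\bot : K) != \top.
  apply/eqP => e; move: K2; rewrite ltnNge => /negP[].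
  rewrite -(cards1 (\bot : K)) -cardsT; apply/subset_leq_card/subsetP => x _.
  by rewrite inE -lex0 e lex1.
have rel (a : skeleton K) x y : x \in block_set a -> y \in block_set a ->
    (x, y) \in chain_tol_set.
  by rewrite -skel_tol_chain; apply: block_tol.
rewrite -(cardC1 (\top : K)) -(card_imset _ (@blk0_inj _ _ (skel_tol K))).
apply: eq_card => x; rewrite !inE; apply/imsetP/idP => [[a _ ->]|xT].
  (* A block starting at the top would be a singleton, and a lower cover of the top could be added
     to it. *)
  apply/eqP => aT; have [y yT Ry] := ex_chain_cocover bT.
  have : y \in block_set a.
    apply: block_max => z; rewrite mem_block aT => /andP[Tz _].
    have -> : z = \top by apply/le_anti; rewrite lex1.
    by rewrite /= skel_tol_chain.
  by rewrite mem_block aT => /andP[]; rewrite (lt_geF yT).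
(* In a block containing [x] and its cover [y], a lower bound below [x] would have [x] strictly
   between itself and [y]. *)
have [y xy Rxy] := ex_chain_cover xT.
rewrite -skel_tol_chain in Rxy.
have [a [ax ay]] := @ex_block _ _ (skel_tol K) _ _ Rxy.
exists a => //; apply/eqP; move: (ax); rewrite mem_block => /andP[x0 _].
rewrite eq_le x0 andbT; apply: contraT => nx.
have h : blk0 a < x by rewrite lt_leAnge x0.
by have /chain_tolP/(_ x)[] := rel a _ _ (blk0_mem a) ay; rewrite h xy.
Qed.

End ChainSkeleton.

(** * Isomorphisms of lattices and of weighted double skeletons *)

Section LatticeIsos.
Context {d1 d2 : Order.disp_t}.

Lemma mono_lattice_iso (L1 : latticeType d1) (L2 : latticeType d2) (f : L1 -> L2) :
  bijective f -> {mono f : x y / x <= y} -> lattice_iso f.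
Proof.
move=> bf mf; have [g gf fg] := bf; split=> // x y; apply/le_anti/andP; split.
- by rewrite lexI !mf leIl leIr.
- by rewrite -[X in X <= _]fg mf lexI -!mf fg leIl leIr.
- by rewrite -[X in _ <= X]fg mf leUx -!mf fg leUl leUr.
- by rewrite leUx !mf leUl leUr.
Qed.

Lemma lattice_iso_bounds (L1 : tbLatticeType d1) (L2 : tbLatticeType d2) (f : L1 -> L2) :
  lattice_iso f -> f \bot = \bot /\ f \top = \top.
Proof.
case=> [[g gf fg]] fI fU; split; apply/le_anti.
  by rewrite le0x andbT -(fg \bot) leEmeet -fI meet0x.
by rewrite lex1 /= -(fg \top) leEmeet -fI meetx1.
Qed.

End LatticeIsos.

(** The flag lets both kinds of bounds, and so all of the double skeleton, be treated uniformly. *)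
Definition bnd d (L : finTBLatticeType d) (R : tolType L)
  (i : bool) (a : factor R) : L := if i then blk1 a else blk0 a.

Lemma dskel_bnd d (L : finTBLatticeType d) i (a : skeleton L) :
  bnd i a \in dskel_set L.
Proof. by case: i; [apply: dskel_blk1|apply: dskel_blk0]. Qed.

Lemma dskelE d (L : finTBLatticeType d) (p : dskel L) :
  exists i a, p = DSkel (dskel_bnd i a).
Proof.
case: (p) => x xP; have := xP; rewrite {1}/dskel_set inE => /orP[]/imsetP[a _ e].
  by exists false, a; apply: val_inj.
by exists true, a; apply: val_inj.
Qed.

Section DoubleSkeletonIso.
Context {d1 d2 : Order.disp_t} {L1 : finTBLatticeType d1} {L2 : finTBLatticeType d2}.

(** The map on bounds is forced by [kappa]. One element may bound several blocks, but the comparison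
    of bounds is preserved and reflected, so its image does not depend on the block chosen. *)
Lemma bnd_wds_isomorphic (kappa : skeleton L1 -> skeleton L2) :
  bijective kappa ->
  (forall i j a b, (bnd i (kappa a) <= bnd j (kappa b)) = (bnd i a <= bnd j b)) ->
  (forall i j a b, bnd i a <= bnd j b ->
     length (itv (bnd i (kappa a)) (bnd j (kappa b)))
     = length (itv (bnd i a) (bnd j b))) ->
  wds_isomorphic (Swd L1) (Swd L2).
Proof.
move=> bk mono len.
have [psi psiE] : exists psi : dskel L1 -> dskel L2, forall p i a,
    p = DSkel (dskel_bnd i a) -> psi p = DSkel (dskel_bnd i (kappa a)).
  apply: (@fin_all_exists _ _ (fun p q => forall i a,
    p = DSkel (dskel_bnd i a) -> q = DSkel (dskel_bnd i (kappa a)))) => p.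
  have [i [a ->]] := dskelE p; exists (DSkel (dskel_bnd i (kappa a))) => j b [e].
  by apply: val_inj; apply/le_anti; rewrite /= !mono e lexx.
have psi_mono : {mono psi : x y / x <= y}.
  move=> p q; have [i [a ep]] := dskelE p; have [j [b eq]] := dskelE q.
  by rewrite (psiE _ _ _ ep) (psiE _ _ _ eq) ep eq; apply: mono.
have psi_inj : injective psi.
  by move=> p q e; apply/le_anti; rewrite -!psi_mono e lexx.
exists psi, kappa; split.
- split=> //; have [k' kk' k'k] := bk.
  have [phi phiK] : exists phi : dskel L2 -> dskel L1, forall q, psi (phi q) = q.
    apply: (@fin_all_exists _ _ (fun q p => psi p = q)) => q.
    have [i [a ->]] := dskelE q; exists (DSkel (dskel_bnd i (k' a))).
    by rewrite (psiE _ i (k' a)) //; apply: val_inj; rewrite /= k'k.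
  by exists phi => // p; apply: psi_inj.
- by apply: mono_lattice_iso => // a b; apply: (mono false false).
- by move=> a; rewrite (psiE _ false a) //; apply: val_inj.
- by move=> a; rewrite (psiE _ true a) //; apply: val_inj.
move=> p q /andP[/ltW pq _].
have [i [a ep]] := dskelE p; have [j [b eq]] := dskelE q.
rewrite (psiE _ _ _ ep) (psiE _ _ _ eq) ep eq /= len //.
by move: pq; rewrite ep eq.
Qed.

End DoubleSkeletonIso.

(** * The lattice of down-sets and the lengths of its intervals *)

Section Downsets.
Variables (T : finType) (e : rel T).

Definition is_downset (A : {set T}) :=
  [forall p, forall q in A, e p q ==> (p \in A)].

Lemma is_downsetP (A : {set T}) :
  reflect (forall p q, e p q -> q \in A -> p \in A) (is_downset A).
Proof.
apply: (iffP forallP) => [h p q epq qA|h p].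
  by have /forall_inP/(_ q qA)/implyP/(_ epq) := h p.
by apply/forall_inP => q qA; apply/implyP => /h; apply.
Qed.

Record downset := Downset { dset :> {set T}; dsetP : is_downset dset }.

HB.instance Definition _ := [isSub for dset].
HB.instance Definition _ := [Finite of downset by <:].

Lemma downset_mem (A : downset) p q : e p q -> q \in dset A -> p \in dset A.
Proof. by move: p q; apply/is_downsetP/dsetP. Qed.

Lemma downsetI_subproof (A B : downset) : is_downset (dset A :&: dset B).
Proof.
apply/is_downsetP => p q epq; rewrite !inE => /andP[qA qB].
by rewrite !(downset_mem epq).
Qed.

Lemma downsetU_subproof (A B : downset) : is_downset (dset A :|: dset B).
Proof.
apply/is_downsetP => p q epq; rewrite !inE => /orP[]qA.
  by rewrite (downset_mem epq qA).
by rewrite (downset_mem epq qA) orbT.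
Qed.

Lemma downset0_subproof : is_downset set0.
Proof. by apply/is_downsetP => p q; rewrite inE. Qed.

Lemma downsetT_subproof : is_downset [set: T].
Proof. by apply/is_downsetP. Qed.

Definition downset_le (A B : downset) := dset A \subset dset B.

Lemma downset_le_refl : reflexive downset_le.
Proof. by move=> A; apply: subxx. Qed.

Lemma downset_le_anti : antisymmetric downset_le.
Proof. by move=> A B AB; apply/val_inj/eqP; rewrite eqEsubset. Qed.

Lemma downset_le_trans : transitive downset_le.
Proof. by move=> B A C; apply: subset_trans. Qed.

Definition downset_display : Order.disp_t := Order.Disp tt tt.

HB.instance Definition _ := Order.Le_isPOrder.Build downset_display downset
  downset_le_refl downset_le_anti downset_le_trans.

Lemma downset_lexI (A B C : downset) :
  (A <= Downset (downsetI_subproof B C)) = (A <= B) && (A <= C).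
Proof. exact: subsetI. Qed.

Lemma downset_leUx (A B C : downset) :
  (Downset (downsetU_subproof A B) <= C) = (A <= C) && (B <= C).
Proof. exact: subUset. Qed.

HB.instance Definition _ := Order.POrder_MeetJoin_isLattice.Build
  downset_display downset downset_lexI downset_leUx.

Lemma downset_meetUl : @left_distributive downset downset Order.meet Order.join.
Proof. by move=> A B C; apply: val_inj; apply: setIUl. Qed.

HB.instance Definition _ := Order.Lattice_Meet_isDistrLattice.Build
  downset_display downset downset_meetUl.

Lemma downset_le0x (A : downset) : Downset downset0_subproof <= A.
Proof. exact: sub0set. Qed.

Lemma downset_lex1 (A : downset) : A <= Downset downsetT_subproof.
Proof. exact: subsetT. Qed.

HB.instance Definition _ :=
  Order.hasBottom.Build downset_display downset downset_le0x.
HB.instance Definition _ :=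
  Order.hasTop.Build downset_display downset downset_lex1.

Lemma downset_leE (A B : downset) : (A <= B) = (dset A \subset dset B).
Proof. by []. Qed.

Lemma downset_ltE (A B : downset) : (A < B) = (dset A \proper dset B).
Proof. by rewrite lt_leAnge. Qed.

Hypotheses (e_irr : irreflexive e) (e_trans : transitive e).

(** A member with the fewest predecessors works: by transitivity and irreflexivity, a predecessor of
    it has strictly fewer. *)
Lemma ex_lower_mem (P : {set T}) p : p \in P ->
  exists2 q, q \in P & forall r, e r q -> r \notin P.
Proof.
move=> pP; case: (arg_minnP (fun q => #|[set r | e r q]|) pP) => q qP qmin.
exists q => // r erq; apply/negP => /qmin; rewrite leqNgt => /negP[].
apply/proper_card/properP; split.
  by apply/subsetP => s; rewrite !inE => /e_trans; apply.
by exists r; rewrite !inE ?e_irr.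
Qed.

(** The new element is minimal in the difference, so all its predecessors already lie in [A]. *)
Lemma downset_add1 (A B : downset) : A < B ->
  exists C : downset, exists2 p, p \notin dset A & dset C = p |: dset A /\ C <= B.
Proof.
rewrite downset_ltE => /properP[AB [p pB pA]].
have pBA : p \in dset B :\: dset A by rewrite inE pA.
have [q + qmin] := ex_lower_mem pBA; rewrite inE => /andP[qA qB].
have dC : is_downset (q |: dset A).
  apply/is_downsetP => r s ers; rewrite !inE => /orP[/eqP es|sA]; last first.
    by rewrite (downset_mem ers) ?orbT.
  rewrite {s}es in ers; have := qmin r ers.
  by rewrite inE (downset_mem ers qB) andbT negbK => ->; rewrite orbT.
exists (Downset dC), q => //; split=> //.
by rewrite downset_leE /= subUset sub1set qB.
Qed.

Lemma downset_chain (A B : downset) : A <= B ->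
  exists C : {set downset},
    [/\ C \subset itv A B, chain C & #|C| = (#|dset B| - #|dset A|).+1].
Proof.
have [n] := ubnP (#|dset B| - #|dset A|)%N; elim: n A => // n IH A leN AB.
have [<-|nAB] := eqVneq A B.
  exists [set A]; rewrite cards1 subnn; split=> //.
    by rewrite sub1set inE lexx.
  apply/forall_inP => x /set1P->; apply/forall_inP => y /set1P->.
  exact: comparablexx.
have ltAB : A < B by rewrite lt_neqAle nAB.
have [A' [p pA [eA' A'B]]] := downset_add1 ltAB.
have cA' : #|dset A'| = #|dset A|.+1 by rewrite eA' cardsU1 pA.
have AA' : A < A'.
  by rewrite downset_ltE properEcard eA' subsetUr -eA' cA' ltnSn.
have cB : (#|dset A| < #|dset B|)%N by rewrite -cA'; apply: subset_leq_card.
have [|C [Citv Cch Ccard]] := IH A' _ A'B.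
  by rewrite cA'; apply: leq_trans (leN : (_ <= n)%N); rewrite ltn_sub2l.
have inC x : x \in C -> A' <= x <= B by move/(subsetP Citv); rewrite inE.
exists (A |: C); split.
- rewrite subUset sub1set inE lexx AB; apply/subsetP => x /inC/andP[h1 h2].
  by rewrite inE h2 (le_trans (ltW AA')).
- apply/forall_inP => x xC; apply/forall_inP => y yC; move: xC yC.
  case/setU1P => [->|xC] /setU1P[->|yC]; first exact: comparablexx.
  + by apply/orP; left; case/andP: (inC y yC) => /(le_trans (ltW AA')).
  + by apply/orP; right; case/andP: (inC x xC) => /(le_trans (ltW AA')).
  by have /forall_inP/(_ x xC)/forall_inP/(_ y yC) := Cch.
rewrite cardsU1 Ccard cA' subnSK //.
suff -> : A \notin C by [].
by apply/negP => /inC/andP[]; rewrite (lt_geF AA').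
Qed.

(** Comparable down-sets of equal cardinality coincide, so cardinality is injective on a chain. *)
Lemma chain_card_le (C : {set downset}) (A B : downset) :
  chain C -> C \subset itv A B -> (#|C| <= (#|dset B| - #|dset A|).+1)%N.
Proof.
move=> Cch Citv; have inC x : x \in C -> A <= x <= B.
  by move/(subsetP Citv); rewrite inE.
(* On [C] the value is in range, so [inord] does not take its default. *)
pose f (x : downset) := inord (#|dset x| - #|dset A|) : 'I_(#|dset B| - #|dset A|).+1.
rewrite -[X in (_ <= X)%N]card_ord; apply: (@leq_card_in _ _ f) => x y xC yC.
move/(congr1 (@nat_of_ord _)); rewrite /f !inordK; first last.
- by rewrite ltnS leq_sub2r //; apply/subset_leq_card; case/andP: (inC x xC).
- by rewrite ltnS leq_sub2r //; apply/subset_leq_card; case/andP: (inC y yC).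
have cA z : z \in C -> (#|dset A| <= #|dset z|)%N.
  by case/inC/andP => h _; apply: subset_leq_card.
move=> /(congr1 (addn^~ #|dset A|)); rewrite !subnK ?cA // => exy.
have /forall_inP/(_ x xC)/forall_inP/(_ y yC)/orP[] := Cch => h; apply/val_inj/eqP.
  by rewrite eqEcard exy leqnn andbT.
by rewrite eq_sym eqEcard exy leqnn andbT.
Qed.

(** This turns the weights of the double skeleton into differences of cardinalities. *)
Lemma length_itv (A B : downset) : A <= B ->
  length (itv A B) = (#|dset B| - #|dset A|)%N.
Proof.
move=> AB; apply/eqP; rewrite eqn_leq; apply/andP; split.
  apply/bigmax_leqP => n /existsP[C /and3P[CI Cch /eqP Cn]].
  by rewrite -ltnS -Cn chain_card_le.
have [C [CI Cch Cn]] := downset_chain AB.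
(* The chain itself shows that this value is within the range of the maximum in [length]. *)
have lt : (#|dset B| - #|dset A| < #|itv A B|)%N by rewrite -Cn subset_leq_card.
apply: (@leq_bigmax_cond _ _ (fun i : 'I__ => i : nat) (Ordinal lt)).
by apply/existsP; exists C; rewrite CI Cch Cn eqxx.
Qed.

(** * The tolerance of pairs whose symmetric difference is an antichain *)

Definition flat_tol_set : {set downset * downset} :=
  [set x | [forall p, forall q, e p q ==>
    ~~ (((p \in dset x.1) (+) (p \in dset x.2))
        && ((q \in dset x.1) (+) (q \in dset x.2)))]].

Lemma flatP (A B : downset) : reflect
  (forall p q, e p q -> ~~ (((p \in dset A) (+) (p \in dset B))
                            && ((q \in dset A) (+) (q \in dset B))))
  ((A, B) \in flat_tol_set).
Proof.
rewrite inE; apply: (iffP forallP) => h p.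
  by move=> q epq; have /forallP/(_ q)/implyP/(_ epq) := h p.
by apply/forallP => q; apply/implyP => epq; apply: h.
Qed.

Lemma flat_leP (A B : downset) : A <= B -> reflect
  (forall p q, e p q -> q \in dset B -> p \notin dset A -> q \in dset A)
  ((A, B) \in flat_tol_set).
Proof.
move=> AB; have sAB p : p \in dset A -> p \in dset B := subsetP AB p.
apply: (iffP (flatP A B)) => [h p q epq qB pA|h p q epq].
  apply: contraNT (h p q epq) => qA.
  by rewrite (negbTE pA) (negbTE qA) qB (downset_mem epq qB).
apply/negP; have := h p q epq; have := sAB p; have := sAB q.
have := @downset_mem A p q epq; have := @downset_mem B p q epq.
by do 4! case: (_ \in _) => //=; do ?[move=> /(_ isT)] => //; auto.
Qed.

Lemma flat_tolerance : tolerance flat_tol_set.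
Proof.
apply/and3P; split.
- by apply/forallP=> A; apply/flatP => p q _; rewrite !addbb.
- apply/forallP => A; apply/forallP => B; apply/implyP => /flatP h.
  by apply/flatP => p q /h; rewrite addbC (addbC (q \in _)).
- apply/forall_inP => -[A B] /flatP h; apply/forall_inP => -[C D] /flatP h'.
  apply/andP; split; apply/flatP => p q epq; move: (h p q epq) (h' p q epq);
  rewrite /= !inE; move: (@downset_mem A p q epq) (@downset_mem B p q epq)
    (@downset_mem C p q epq) (@downset_mem D p q epq);
  do 4! case: (q \in _) => /=; do ?[move=> /(_ isT)->];
  by do ?[case: (p \in _) => //=] => //; do ?[move=> /(_ isT)].
Qed.

Lemma down_subproof p : is_downset [set r | (r == p) || e r p].
Proof.
apply/is_downsetP => r s ers; rewrite !inE => /orP[/eqP<-|/(e_trans ers)->].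
  by rewrite ers orbT.
by rewrite orbT.
Qed.
Definition down p := Downset (down_subproof p).

(** If [p] is below [q] and both lie in [B] but not in [A], then adding [down p] to [A] gives a
    down-set strictly between: it gains [p] and still misses [q]. *)
Lemma flat_glued : glued (Tol flat_tolerance).
Proof.
apply/glued_covers => A B /andP[AB /forallP cov] /=.
apply/(flat_leP (ltW AB)) => p q epq qB pA; apply: contraT => qA.
have /negP[] := cov (A `|` down p); rewrite !downset_ltE /=.
apply/andP; split; apply/properP; split.
- exact: subsetUl.
- by exists p => //; rewrite !inE eqxx orbT.
- apply/subsetP => r; rewrite !inE => /or3P[|/eqP->|erp].
  + exact: (subsetP (ltW AB)).
  + exact: downset_mem epq qB.
  + exact: downset_mem (e_trans erp epq) qB.
- exists q => //; rewrite !inE (negbTE qA) /= negb_or; apply/andP; split.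
    by apply/eqP => qp; rewrite qp e_irr in epq.
  by apply/negP => /(e_trans epq); rewrite e_irr.
Qed.

(** For a comparable pair whose difference is an antichain, each single element of the difference
    can be added to the smaller set and yields a cover of it. A glued tolerance contains these
    covers, and joining them reaches the larger set. *)
Lemma flat_minimal (S : tolType downset) :
  glued S -> Tol flat_tolerance \subset (S : {set downset * downset}).
Proof.
move=> /glued_covers covS; apply/subsetP => -[A B] AB.
(* Meet and join have the same symmetric difference as [A] and [B]; convexity then reduces the claim
   to comparable pairs. *)
have : (A `&` B, A `|` B) \in flat_tol_set.
  have := tolI AB (tol_sym (R := Tol flat_tolerance) AB).
  have := tolU AB (tol_sym (R := Tol flat_tolerance) AB).
  rewrite meetC joinC => h1 h2; apply/flatP => p q epq.
  have := flatP A B AB p q epq; rewrite !inE.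
  by do 4!case: (_ \in _).
suff le C D : C <= D -> (C, D) \in flat_tol_set ->
    (C, D) \in (S : {set downset * downset}).
  move=> /le h; apply: (tol_convex (h _)); rewrite ?leIl ?leIr ?leUl ?leUr //.
  by apply: le_trans (leIl _ _) (leUl _ _).
move=> {A B AB} CD flat.
pose P E := (C <= E <= D) && ((C, E) \in (S : {set downset * downset})).
have PC : P C by rewrite /P lexx CD tol_refl.
case: (@arg_maxnP _ C P (fun E : downset => #|dset E|) PC) => E.
move=> /andP[/andP[CE ED] SE] Emax.
have [<- //|nED] := eqVneq E D.
have /properP[_ [p pD pE]] : dset E \proper dset D.
  by rewrite -downset_ltE lt_neqAle nED.
have pC : p \notin dset C by apply: contra pE; apply/subsetP.
have dC' : is_downset (p |: dset C).
  apply/is_downsetP => r s ers; rewrite !inE => /orP[/eqP es|sC]; last first.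
    by rewrite (downset_mem ers) ?orbT.
  rewrite {s}es in ers; case: (boolP (r \in dset C)) => rC; rewrite ?orbT // orbF.
  by rewrite (flat_leP CD flat r p ers pD rC) in pC.
pose C' := Downset dC'.
have cov : covers C C'.
  rewrite /covers !downset_ltE properEcard subsetUr cardsU1 pC ltnSn /=.
  apply/forallP => W; apply/negP; rewrite !downset_ltE.
  case/andP => /proper_card h1 /proper_card.
  by rewrite /= cardsU1 pC ltnNge h1.
(* Joining the two related pairs enlarges [E] by [p], against its maximality. *)
have SE' := tolU SE (covS _ _ cov); rewrite joinxx in SE'.
have PE' : P (E `|` C').
  rewrite /P SE' andbT leUx ED (le_trans CE (leUl _ _)) /=.
  by rewrite downset_leE subUset sub1set pD.
have : (#|dset (E `|` C')| <= #|dset E|)%N := Emax _ PE'.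
rewrite leqNgt => /negP[]; apply/proper_card/properP; split.
  exact: subsetUl.
by exists p => //; rewrite !inE eqxx orbT.
Qed.

Lemma skel_tol_downset : skel_tol_set downset = flat_tol_set.
Proof. exact: skel_tolE flat_glued flat_minimal. Qed.

(** * How the two bounds of a block determine each other *)

Definition inner (E : {set T}) : {set T} := [set p in E | [exists q in E, e p q]].

(** For a down-set [D] this adds exactly the minimal elements of its complement. *)
Definition outer (D : {set T}) : {set T} := [set q | [forall p, e p q ==> (p \in D)]].

Lemma inner_downset (E : downset) : is_downset (inner E).
Proof.
apply/is_downsetP => p q epq; rewrite !inE => /andP[qE _].
by rewrite (downset_mem epq qE); apply/exists_inP; exists q.
Qed.

Lemma outer_downset (D : downset) : is_downset (outer D).
Proof.
apply/is_downsetP => p q epq; rewrite !inE => /forallP h.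
by apply/forallP => r; apply/implyP => erp; apply: (implyP (h r)); apply: e_trans epq.
Qed.

Lemma sub_outer (D : downset) : dset D \subset outer D.
Proof.
by apply/subsetP => q qD; rewrite inE; apply/forallP => p; apply/implyP => /downset_mem->.
Qed.

Lemma flat_inner (A E : downset) : A <= E ->
  ((A, E) \in flat_tol_set) = (inner E \subset dset A).
Proof.
move=> AE; apply/(flat_leP AE)/subsetP => [h p|h p q epq qE pA].
  rewrite inE => /andP[pE /exists_inP[q qE epq]]; apply: contraT => pA.
  by have := h p q epq qE pA => qA; rewrite (downset_mem epq qA) in pA.
by rewrite h // in pA; rewrite inE (downset_mem epq qE); apply/exists_inP; exists q.
Qed.

Lemma flat_outer (D A : downset) : D <= A ->
  ((D, A) \in flat_tol_set) = (dset A \subset outer D).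
Proof.
move=> DA; apply/(flat_leP DA)/subsetP => [h q qA|h p q epq qA pD].
  rewrite inE; apply/forallP => p; apply/implyP => epq; apply: contraT => pD.
  by have := h p q epq qA pD => qD; rewrite (downset_mem epq qD) in pD.
have := h q qA; rewrite inE => /forallP/(_ p)/implyP/(_ epq) pD'.
by rewrite pD' in pD.
Qed.

Lemma blk01_flat (a : skeleton downset) : (blk0 a, blk1 a) \in flat_tol_set.
Proof. by rewrite -skel_tol_downset; apply: block_tol (blk0_mem a) (blk1_mem a). Qed.

(** One inclusion holds because the two bounds are related. Conversely, [inner (blk1 a)] is related
    to every member of the block, so maximality puts it into the block. *)
Lemma blk0_inner (a : skeleton downset) : dset (blk0 a) = inner (blk1 a).
Proof.
have sub : inner (blk1 a) \subset dset (blk0 a).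
  by rewrite -flat_inner ?blk0_le_blk1 ?blk01_flat.
apply/eqP; rewrite eqEsubset sub andbT.
suff : Downset (inner_downset (blk1 a)) \in block_set a by rewrite mem_block => /andP[].
apply: block_max => A; rewrite mem_block => /andP[A0 A1] /=.
rewrite skel_tol_downset.
apply: (tol_convex (R := Tol flat_tolerance)
  (u := Downset (inner_downset (blk1 a))) (v := blk1 a)) => //=.
- by rewrite flat_inner // downset_leE; apply: subset_trans sub (blk0_le_blk1 a).
- by rewrite downset_leE; apply: subset_trans sub (blk0_le_blk1 a).
- by rewrite downset_leE; apply: subset_trans sub A0.
Qed.

Lemma blk1_outer (a : skeleton downset) : dset (blk1 a) = outer (blk0 a).
Proof.
have sub : dset (blk1 a) \subset outer (blk0 a).
  by rewrite -flat_outer ?blk0_le_blk1 ?blk01_flat.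
apply/eqP; rewrite eqEsubset sub /=.
suff : Downset (outer_downset (blk0 a)) \in block_set a by rewrite mem_block => /andP[].
apply: block_max => A; rewrite mem_block => /andP[A0 A1] /=.
rewrite skel_tol_downset.
apply: (tol_convex (R := Tol flat_tolerance)
  (u := blk0 a) (v := Downset (outer_downset (blk0 a)))) => //=.
- by rewrite flat_outer // downset_leE; apply: sub_outer.
- by rewrite downset_leE; apply: sub_outer.
- by rewrite downset_leE; apply: subset_trans A1 sub.
Qed.

(** [D] and [outer D] share a block. Its upper bound contains [outer D], and [inner] is monotone, so
    its lower bound contains [D]. *)
Lemma ex_skeleton_block (D : downset) : inner (outer D) = dset D ->
  exists a : skeleton downset, blk0 a = D.
Proof.
move=> DE; pose E := Downset (outer_downset D).
have DleE : D <= E by apply: sub_outer.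
have DE_tol : (D, E) \in (skel_tol downset : {set downset * downset}).
  by rewrite /= skel_tol_downset flat_inner // DE.
have [a [Da Ea]] := ex_block DE_tol; exists a; apply/le_anti.
move: Da Ea; rewrite !mem_block => /andP[-> _] /andP[_ Ea] /=.
rewrite downset_leE -DE blk0_inner; apply/subsetP => p.
rewrite !inE => /andP[pE /exists_inP[q qE epq]].
have sE := subsetP Ea; rewrite sE ?inE //; apply/exists_inP; exists q => //.
exact: sE.
Qed.

End Downsets.

(** * Join-irreducible down-sets, and a decomposition invariant *)

Lemma length_Ji_downset (T : finType) (e : rel T) :
  (forall p q r, e p q -> ~~ e q r) -> (length (Ji (downset e)) <= 1)%N.
Proof.
move=> e_ht.
have e_irr : irreflexive e.
  by move=> p; apply/negP => epp; have := e_ht _ _ p epp; rewrite epp.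
have e_trans : transitive e by move=> q p r epq eqr; have := e_ht _ _ r epq; rewrite eqr.
have JiE (A : downset e) : A \in Ji (downset e) -> exists q, A = down e_trans q.
  rewrite inE => /andP[A0 /forallP JA].
  (* With no three-element chain, a member having a predecessor is maximal; if no member has one,
     every member is maximal in [A]. *)
  have [q qA qmax] : exists2 q, q \in dset A & forall r, e q r -> r \notin dset A.
    case: (boolP [exists q in dset A, exists p, e p q]).
      case/exists_inP => q qA /existsP[p epq]; exists q => // r.
      by rewrite (negbTE (e_ht _ _ _ epq)).
    rewrite negb_exists_in => /forall_inP h.
    have [q qA] : exists q, q \in dset A.
      by apply/set0Pn; apply: contra A0 => /eqP A0; apply/eqP/val_inj.
    exists q => // r eqr; apply/negP => /h/existsP[]; by exists q.
  exists q; have dq : is_downset e (dset A :\ q).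
    apply/is_downsetP => r s ers; rewrite !inE => /andP[_ sA].
    rewrite (downset_mem ers sA) andbT; apply: contraTneq sA => rq.
    by rewrite qmax // -rq.
  (* [A] is the join of [down q] and [A] without [q], and it differs from the latter. *)
  have /forallP/(_ (Downset dq))/implyP := JA (down e_trans q).
  case/(_ _)/orP => [|/eqP //|]; last first.
    by move/eqP/(congr1 (fun A : downset e => q \in dset A)); rewrite qA !inE eqxx.
  apply/eqP/val_inj/setP => r; rewrite !inE /=.
  have [->|_] /= := eqVneq r q; first by rewrite qA.
  by case: (boolP (e r q)) => //= /downset_mem->.
apply/bigmax_leqP => n /existsP[C /and3P[CJ Cch /eqP Cn]].
rewrite -ltnS -Cn -card_bool.
(* On a chain of principal down-sets this Boolean is injective: if [p] is strictly below [q], then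
   [down p] is a singleton and [down q] is not. *)
apply: (@leq_card_in _ _ (fun A : downset e => (1 < #|dset A|)%N)) => A B AC BC.
wlog AB : A B AC BC / A <= B.
  move=> h; have /forall_inP/(_ A AC)/forall_inP/(_ B BC)/orP[AB|BA] := Cch.
    exact: h.
  by move=> /esym/(h B A BC AC BA)->.
have [p eA] := JiE A (subsetP CJ A AC); have [q eB] := JiE B (subsetP CJ B BC).
have : p \in dset B by rewrite (subsetP AB) // eA !inE eqxx.
rewrite eB !inE => /orP[/eqP pq _|epq]; first by rewrite eA pq.
have -> : dset A = [set p].
  rewrite eA; apply/setP => r; rewrite !inE.
  by case: (boolP (e r p)) => [/(e_ht r p q)|_]; rewrite ?epq ?orbF.
have -> : (1 < #|dset (down e_trans q)|)%N.
  apply/card_gt1P; exists p, q; rewrite !inE eqxx epq orbT; split=> //.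
  by apply: contraTneq epq => ->; rewrite e_irr.
by rewrite cards1.
Qed.

(** For a distributive lattice this is a decomposition into three nontrivial direct factors, written
    internally. *)
Definition splits3 d (L : tbLatticeType d) := exists x y z : L,
  [/\ x != \bot, y != \bot, z != \bot
    & [/\ x `&` y = \bot, x `&` z = \bot, y `&` z = \bot
        & x `|` y `|` z = \top]].

Lemma splits3_iso d1 d2 (L1 : tbLatticeType d1) (L2 : tbLatticeType d2) :
  lattice_isomorphic L1 L2 -> splits3 L1 -> splits3 L2.
Proof.
case=> f fiso [x [y [z [x0 y0 z0 [xy xz yz xyz]]]]].
have [f0 f1] := lattice_iso_bounds fiso; have [/bij_inj fi fI fU] := fiso.
have neq0 t : t != \bot -> f t != \bot by rewrite -f0 (inj_eq fi).
exists (f x), (f y), (f z); rewrite !neq0 //; split=> //.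
by rewrite -!fI -!fU xy xz yz xyz f0 f1.
Qed.

(** * The family of orders and its three-block skeletons *)

Section Kite.
Variables (X : finType) (Y Z : {set X}).
Notation Q := (option (option X)).

(* [None] and [Some None] are the elements [c] and [b] of the header. *)
Definition kite : rel Q := fun p q =>
  match p, q with
  | None, Some None => true
  | None, Some (Some x) => x \notin Z
  | Some (Some x), Some None => x \in Y
  | _, _ => false
  end.

Lemma kite_irr : irreflexive kite. Proof. by case=> [[]|]. Qed.

Lemma kite_trans : transitive kite.
Proof. by case=> [[?|]|] [[?|]|] [[?|]|]. Qed.

Definition kite_set (bot top : bool) (F : {set X}) : {set Q} :=
  [set p | match p with
           | None => bot | Some None => top | Some (Some x) => x \in F end].

Lemma kite_setS b t F b' t' F' : (kite_set b t F \subset kite_set b' t' F')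
  = [&& b ==> b', t ==> t' & F \subset F'].
Proof.
apply/subsetP/and3P => [h|[hb ht /subsetP hF] p].
  split; first by have := h None; rewrite !inE => /implyP.
    by have := h (Some None); rewrite !inE => /implyP.
  by apply/subsetP => x; have := h (Some (Some x)); rewrite !inE.
by rewrite !inE; case: p => [[x|]|]; [exact: hF|exact/implyP|exact/implyP].
Qed.

Lemma card_kite_set b t F : #|kite_set b t F| = (b + t + #|F|)%N.
Proof.
have c0 : #|kite_set false false F| = #|F|.
  have inj : injective (fun x : X => Some (Some x)) by move=> x y [].
  rewrite -(card_imset _ inj); apply: eq_card => -[[x|]|]; rewrite !inE /=.
  - by rewrite (mem_imset _ _ inj).
  - by apply/esym/imsetP => -[].
  - by apply/esym/imsetP => -[].
have ct : #|kite_set false t F| = (t + #|F|)%N.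
  case: t => //=; have -> : kite_set false true F = Some None |: kite_set false false F.
    by apply/setP => -[[x|]|]; rewrite !inE.
  by rewrite cardsU1 !inE c0.
case: b => //=; have -> : kite_set true t F = None |: kite_set false t F.
  by apply/setP => -[[x|]|]; rewrite !inE.
by rewrite cardsU1 !inE ct addnA.
Qed.

(* The bounds of the [k]-th block, for the order [None], [Some false], [Some true]
   of the indices. *)
Definition kite_bnd (i : bool) (k : option bool) : {set Q} :=
  match i, k with
  | false, None => kite_set false false set0
  | false, Some false => kite_set true false set0
  | false, Some true => kite_set true false Y
  | true, None => kite_set true false Z
  | true, Some false => kite_set true false setT
  | true, Some true => kite_set true true setT
  end.

Lemma kite_bnd_downset k : is_downset kite (kite_bnd false k).
Proof.
by apply/is_downsetP; case: k => [[]|] [[x|]|] [[y|]|] //=; rewrite !inE.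
Qed.

Hypotheses (Y0 : Y != set0) (ZT : Z != setT).

(** What survives the removal of the maximal elements of a down-set: [b] keeps [c] and [Y], a member
    of [X] outside [Z] keeps just [c], and otherwise nothing is kept. *)
Definition kite_index (E : {set Q}) : option bool :=
  if Some None \in E then Some true
  else if [exists x, (x \notin Z) && (Some (Some x) \in E)] then Some false
  else None.

Lemma inner_kite (E : {set Q}) :
  is_downset kite E -> inner kite E = kite_bnd false (kite_index E).
Proof.
move=> /is_downsetP dE; rewrite /kite_index; case: ifPn => [bE|bE].
  apply/setP => -[[x|]|]; rewrite !inE /=.
  - apply/andP/idP => [[_ /exists_inP[[[y|]|] _ //]]|xY].
    by split; [apply: dE bE|apply/exists_inP; exists (Some None)].
  - by rewrite bE; apply/exists_inP => -[[[y|]|]].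
  - rewrite (dE _ _ _ bE) //; apply/exists_inP; by exists (Some None).
case: ifPn => [/existsP[x /andP[xZ xE]]|].
  apply/setP => -[[y|]|]; rewrite !inE /=.
  - by apply/negP => /andP[_ /exists_inP[[[z|]|] // bE']]; rewrite bE' in bE.
  - by rewrite (negbTE bE).
  - rewrite (dE _ _ _ xE) //; apply/exists_inP; by exists (Some (Some x)).
rewrite negb_exists => /forallP nE.
apply/setP => -[[y|]|]; rewrite !inE /=.
- by apply/negP => /andP[_ /exists_inP[[[z|]|] // bE']]; rewrite bE' in bE.
- by rewrite (negbTE bE).
apply/negP => /andP[_ /exists_inP[[[y|]|] // yE h]].
  by have := nE y; rewrite h yE.
by rewrite yE in bE.
Qed.

Lemma outer_kite k : outer kite (kite_bnd false k) = kite_bnd true k.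
Proof.
(* This element below [b] is missing from the first two lower bounds and so keeps [b] out of their
   upper bounds. *)
have [x0 x0Y] : exists x, x \in Y by apply/set0Pn.
apply/setP => -[[x|]|]; rewrite !inE; case: k => [[]|] /=; rewrite ?inE;
  apply/forallP.
- by case=> [[y|]|] //=; rewrite !inE ?implybT.
- by case=> [[y|]|] //=; rewrite !inE ?implybT.
- case: (boolP (x \in Z)) => xZ.
    by case=> [[y|]|] //=; rewrite !inE ?xZ.
  by move/(_ None); rewrite /= !inE xZ.
- by case=> [[y|]|] //=; rewrite !inE ?implybb.
- by move/(_ (Some (Some x0))); rewrite /= !inE x0Y.
- by move/(_ (Some (Some x0))); rewrite /= !inE x0Y.
- by case=> [[y|]|] //=; rewrite !inE ?implybb.
- by case=> [[y|]|] //=; rewrite !inE ?implybb.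
- by case=> [[y|]|] //=; rewrite !inE ?implybb.
Qed.

Lemma inner_kite_bnd k : inner kite (kite_bnd true k) = kite_bnd false k.
Proof.
have dE : is_downset kite (kite_bnd true k).
  rewrite -outer_kite.
  exact: (outer_downset kite_trans (Downset (kite_bnd_downset k))).
rewrite inner_kite //; congr kite_bnd; rewrite /kite_index.
(* Such an [x] lies above [c], so [c] is not maximal in the second upper bound. *)
have [x xZ] : exists x, x \notin Z.
  have : ~: Z != set0 by rewrite -setCT (inj_eq (@setC_inj X)).
  by case/set0Pn => x; rewrite inE; exists x.
case: k {dE} => [[]|] /=; rewrite !inE //.
  by case: ifPn => // /existsP[]; exists x; rewrite xZ !inE.
by case: ifPn => // /existsP[y]; rewrite !inE; case: (y \in Z).
Qed.

Lemma kite_bnd_inj : injective (kite_bnd false).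
Proof.
have [x xY] : exists x, x \in Y by apply/set0Pn.
move=> k l /setP h; have := h None; have := h (Some (Some x)).
by case: k {h} => [[]|]; case: l => [[]|]; rewrite !inE ?xY.
Qed.

(** The three lower bounds are fixed by [inner] after [outer], so they give blocks; there are no
    others, since [inner] of any down-set is one of the three. *)
Lemma kite_skeleton : exists g : option bool -> skeleton (downset kite),
  bijective g /\ forall i k, dset (bnd i (g k)) = kite_bnd i k.
Proof.
have ex k : exists a : skeleton (downset kite), dset (blk0 a) = kite_bnd false k.
  have [|a e] := ex_skeleton_block kite_irr kite_trans
    (D := Downset (kite_bnd_downset k)).
    by rewrite /= outer_kite inner_kite_bnd.
  by exists a; rewrite e.
have [g gE] := fin_all_exists ex; exists g; split; last first.
  by case=> k; [rewrite /= (blk1_outer kite_irr kite_trans) gE outer_kite|apply: gE].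
have [h hE] : exists h : skeleton (downset kite) -> option bool, forall a, g (h a) = a.
  apply: (@fin_all_exists _ _ (fun a k => g k = a)) => a.
  exists (kite_index (blk1 a)); apply/blk0_inj/val_inj; rewrite /= gE.
  by rewrite (blk0_inner kite_irr kite_trans) inner_kite ?dsetP.
exists h => // k; apply: kite_bnd_inj; by rewrite -!gE hE.
Qed.

Lemma card_kite_skeleton : #|skeleton (downset kite)| = 3.
Proof.
have [g [bg _]] := kite_skeleton.
by rewrite -(bij_eq_card bg) card_option card_bool.
Qed.

Lemma kite_skeleton_total : total (<=%O : rel (skeleton (downset kite))).
Proof.
have [g [[h gh hg] gE]] := kite_skeleton => a b.
rewrite -[a]hg -[b]hg.
suff le k l : (g k <= g l) = (kite_bnd false k \subset kite_bnd false l).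
  rewrite !le; case: (h a) => [[]|]; case: (h b) => [[]|]; rewrite !kite_setS /=;
    by rewrite ?sub0set ?orbT ?subxx.
by rewrite -!gE.
Qed.

Lemma card_skeleton2_kite : #|skeleton (skeleton (downset kite))| = 2.
Proof. by rewrite (card_total_skeleton kite_skeleton_total) card_kite_skeleton. Qed.

Lemma kite_H3_irreducible : H_irreducible 3 (downset kite).
Proof.
rewrite /H_irreducible cardsT (card_total_skeleton (total_skeleton kite_skeleton_total)).
  by rewrite card_skeleton2_kite.
by rewrite card_skeleton2_kite.
Qed.

Lemma kite_not_H2_irreducible : ~~ H_irreducible 2 (downset kite).
Proof. by rewrite /H_irreducible cardsT card_skeleton2_kite. Qed.

End Kite.

(** * Coinciding weighted double skeletons *)

Lemma kite_wds_isomorphic (X : finType) (Y Z Y' Z' : {set X}) :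
  ~~ (Y \subset Z) -> ~~ (Z \subset Y) -> ~~ (Y' \subset Z') -> ~~ (Z' \subset Y') ->
  #|Y| = #|Y'| -> #|Z| = #|Z'| ->
  wds_isomorphic (Swd (downset (kite Y Z))) (Swd (downset (kite Y' Z'))).
Proof.
have nz (A B : {set X}) : ~~ (A \subset B) -> (A != set0) * (B != setT).
  by move=> AB; split; apply: contraNneq AB => ->; rewrite ?sub0set ?subsetT.
move=> YZ ZY YZ' ZY' cY cZ.
have [g [[h gh hg] gE]] := kite_skeleton (nz _ _ YZ).1 (nz _ _ YZ).2.
have [g' [[h' gh' hg'] gE']] := kite_skeleton (nz _ _ YZ').1 (nz _ _ YZ').2.
(* Since [Y] and [Z] are incomparable, hence nonempty and proper, every inclusion among the six
   bounds has a fixed truth value. *)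
have le i j k l : (kite_bnd Y' Z' i k \subset kite_bnd Y' Z' j l)
    = (kite_bnd Y Z i k \subset kite_bnd Y Z j l).
  pose nzF := (negbTE (nz _ _ YZ).1, negbTE (nz _ _ YZ').1,
    negbTE (nz _ _ ZY).1, negbTE (nz _ _ ZY').1, negbTE (nz _ _ YZ).2,
    negbTE (nz _ _ YZ').2, negbTE (nz _ _ ZY).2, negbTE (nz _ _ ZY').2).
  pose subF := (negbTE YZ, negbTE ZY, negbTE YZ', negbTE ZY').
  by case: i; case: j; case: k => [[]|]; case: l => [[]|]; rewrite !kite_setS //=;
    rewrite ?sub0set ?subsetT ?subxx ?subset0 ?subTset ?subF ?nzF.
have card i k : #|kite_bnd Y' Z' i k| = #|kite_bnd Y Z i k|.
  by case: i; case: k => [[]|]; rewrite /= !card_kite_set ?cY ?cZ.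
have mono i j a b : (bnd i (g' (h a)) <= bnd j (g' (h b))) = (bnd i a <= bnd j b).
  by rewrite !downset_leE !gE' le -!gE !hg.
apply: (@bnd_wds_isomorphic _ _ _ _ (g' \o h)) => //.
  by exists (g \o h') => x /=; rewrite ?gh' ?hg ?gh ?hg'.
move=> i j a b ab /=.
rewrite !(length_itv (@kite_irr _ _ _) (@kite_trans _ _ _)) //; last by rewrite mono.
by rewrite !gE' !card -!gE !hg.
Qed.

(** * Direct decompositions of the lattices of the family *)

Section KiteSplitting.
Variables (X : finType) (Y Z : {set X}).

(** Members of [Z] outside [Y] are comparable to nothing else: two of them split off as singletons,
    and the rest, containing [c], is the third factor. *)
Lemma kite_splits3 : (1 < #|Z :\: Y|)%N -> splits3 (downset (kite Y Z)).
Proof.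
case/card_gt1P => v [w [/setDP[vZ vY] /setDP[wZ wY] vw]].
have single x : x \in Z -> is_downset (kite Y Z) [set Some (Some x)].
  move=> xZ; apply/is_downsetP => -[[p|]|] q //=; rewrite inE;
    by case: q => [[q|]|] // qZ /eqP[e]; rewrite e xZ in qZ.
have rest : is_downset (kite Y Z) (~: [set Some (Some v); Some (Some w)]).
  apply/is_downsetP => -[[p|]|] [[q|]|] //=; rewrite !inE // => pY _.
  by apply/norP; split; apply: contraTneq pY => -[->].
exists (Downset (single v vZ)), (Downset (single w wZ)), (Downset rest); split.
- by apply/eqP => /(congr1 val)/setP/(_ (Some (Some v))); rewrite !inE eqxx.
- by apply/eqP => /(congr1 val)/setP/(_ (Some (Some w))); rewrite !inE eqxx.
- by apply/eqP => /(congr1 val)/setP/(_ None); rewrite !inE.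
split; apply/val_inj/setP => p; rewrite !inE.
- by case: eqP => //= ->; apply: contraNF vw => /eqP[->].
- by case: eqP.
- by case: eqP; rewrite ?orbT.
- by case: eqP => //=; case: eqP.
Qed.

(** Without [c], [A] contains neither [b] nor any element above [c], so its members lie in [Z]. Then
    [b] is in [B], which therefore contains [Y]. *)
Lemma kite_complement (A B : downset (kite Y Z)) :
  A != \bot -> None \notin dset A -> A `&` B = \bot -> A `|` B = \top ->
  exists2 v, v \in Z :\: Y & Some (Some v) \in dset A.
Proof.
move=> A0 cA /(congr1 val)/setP AB0 /(congr1 val)/setP AB1.
have [p pA] : exists p, p \in dset A.
  by apply/set0Pn; apply: contra A0 => /eqP A0; apply/eqP/val_inj.
have bA : Some None \notin dset A by apply: contra cA; apply: downset_mem.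
case: p pA => [[v|]|] pA; last 2 first.
- by rewrite pA in bA.
- by rewrite pA in cA.
exists v => //; apply/setDP; split.
  by apply: contraNT cA => vZ; apply: downset_mem pA.
apply: contraTN pA => vY; have := AB0 (Some (Some v)); rewrite !inE.
have := AB1 (Some None); rewrite !inE (negbTE bA) /= => bB.
by rewrite (@downset_mem _ _ B _ _ _ bB) // andbT => ->.
Qed.

(** At most one of three disjoint elements contains [c]. Each of two others is complemented, so it
    has a member in [Z] outside [Y]; disjointness makes these members distinct. *)
Lemma splits3_kite : splits3 (downset (kite Y Z)) -> (1 < #|Z :\: Y|)%N.
Proof.
case=> x [y [z [x0 y0 z0 [xy xz yz xyz]]]].
have pair (A B A' B' : downset (kite Y Z)) :
    A != \bot -> A' != \bot -> None \notin dset A -> None \notin dset A' ->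
    A `&` B = \bot -> A `|` B = \top -> A' `&` B' = \bot -> A' `|` B' = \top ->
    A `&` A' = \bot -> (1 < #|Z :\: Y|)%N.
  move=> A0 A0' cA cA' AB ABT AB' ABT' AA'.
  have [v vZY vA] := kite_complement A0 cA AB ABT.
  have [w wZY wA] := kite_complement A0' cA' AB' ABT'.
  apply/card_gt1P; exists v, w; split=> //; apply: contraTneq wA => <-.
  by have /setP/(_ (Some (Some v))) := congr1 val AA'; rewrite !inE vA /= => ->.
have disj (A B : downset (kite Y Z)) :
    A `&` B = \bot -> None \in dset A -> None \notin dset B.
  by move=> /(congr1 val)/setP/(_ None); rewrite !inE => + cA; rewrite cA /= => ->.
have xP : x `&` (y `|` z) = \bot by rewrite meetUr xy xz joinxx.
have yP : y `&` (x `|` z) = \bot by rewrite meetUr meetC xy yz joinxx.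
have zP : z `&` (x `|` y) = \bot by rewrite meetUr meetC xz meetC yz joinxx.
have xT : x `|` (y `|` z) = \top by rewrite joinA.
have yT : y `|` (x `|` z) = \top by rewrite joinCA joinA.
have zT : z `|` (x `|` y) = \top by rewrite joinC.
case: (boolP (None \in dset x)) => cx.
  exact: pair y0 z0 (disj _ _ xy cx) (disj _ _ xz cx) yP yT zP zT yz.
case: (boolP (None \in dset y)) => cy.
  exact: pair x0 z0 cx (disj _ _ yz cy) xP xT zP zT xz.
exact: pair x0 y0 cx cy xP xT yP yT xy.
Qed.

End KiteSplitting.

(** * The concrete examples *)

Theorem mainTheorem2 :
  (exists (d1 d2 : Order.disp_t)
          (L1 : finTBDistrLatticeType d1) (L2 : finTBDistrLatticeType d2),
     [/\ H_irreducible 3 L1, H_irreducible 3 L2,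
         wds_isomorphic (Swd L1) (Swd L2) & ~ lattice_isomorphic L1 L2])
  /\
  (exists (d : Order.disp_t) (L : finTBDistrLatticeType d),
     (length (Ji L) <= 1)%N /\ ~~ H_irreducible 2 L).
Proof.
split.
  (* All three sets have two elements, but [Z1] is disjoint from [Y] while [Z2] meets it in one
     point. *)
  pose Y : {set bool * bool} := [set x | x.1].
  pose Z1 : {set bool * bool} := [set x | ~~ x.1].
  pose Z2 : {set bool * bool} := [set x | x.2].
  have YZ1 : ~~ (Y \subset Z1) by apply/subsetPn; exists (true, true); rewrite !inE.
  have Z1Y : ~~ (Z1 \subset Y) by apply/subsetPn; exists (false, true); rewrite !inE.
  have YZ2 : ~~ (Y \subset Z2) by apply/subsetPn; exists (true, false); rewrite !inE.
  have Z2Y : ~~ (Z2 \subset Y) by apply/subsetPn; exists (false, true); rewrite !inE.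
  have Y0 : Y != set0 by apply/set0Pn; exists (true, true); rewrite inE.
  have Z1T : Z1 != setT by apply: contraNneq YZ1 => ->; apply: subsetT.
  have Z2T : Z2 != setT by apply: contraNneq YZ2 => ->; apply: subsetT.
  exists _, _, (downset (kite Y Z1)), (downset (kite Y Z2)); split.
  - exact: kite_H3_irreducible.
  - exact: kite_H3_irreducible.
  - apply: kite_wds_isomorphic => //.
    (* The preimage of [Z2] under this map is [Z1]. *)
    have inj : injective (fun x : bool * bool => (x.2, ~~ x.1)).
      by move=> [a b] [a' b'] [-> /negb_inj->].
    by rewrite -(card_preimset Z2 inj); apply: eq_card => x; rewrite !inE.
  move=> iso; have two : (1 < #|Z1 :\: Y|)%N.
    by apply/card_gt1P; exists (false, true), (false, false); rewrite !inE.
  have := splits3_kite (splits3_iso iso (kite_splits3 two)).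
  have -> : Z2 :\: Y = [set (false, true)] by apply/setP => -[[] []]; rewrite !inE.
  by rewrite cards1.
(* With [Y] inside [Z] no member of [X] lies between [c] and [b]; [true] makes [Y] nonempty and
   [false] makes [Z] proper. *)
exists _, (downset (kite [set true] [set true])); split.
  apply: length_Ji_downset => -[[p|]|] [[q|]|] [[r|]|] //=.
apply: kite_not_H2_irreducible; first by apply/set0Pn; exists true; rewrite inE.
by apply/eqP => /setP/(_ false); rewrite !inE.
Qed.
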